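(* Let $(L_n)_{n\ge 0}$ be the Lucas sequence defined by $L_0=2$, $L_1=1$ and $L_{n+2}=L_{n+1}+L_n$ for all $n\ge 0$. Then there is no $n\ge 0$ such that $L_n$ is a Lehmer number; that is, there is no integer $n\ge 0$ such that $L_n$ is composite and $\phi(L_n)$ divides $L_n-1$.
   Context: Here $\phi$ denotes Euler's totient function. A composite positive integer $N$ is called a Lehmer number if $\phi(N)$ divides $N-1$. *)

(* Defs.v *)
From mathcomp Require Import all_boot.

Set Implicit Arguments.
Unset Strict Implicit.
Unset Printing Implicit Defensive.

Fixpoint lucas (n : nat) : nat :=
  match n with
  | 0 => 2
  | 1 => 1
  | (m.+1 as k).+1 => lucas k + lucas m
  end.

Definition composite (N : nat) : bool := (1 < N) && ~~ prime N.

(* On composite N the truncated subtraction N - 1 is the usual one. *)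
Definition lehmer (N : nat) : bool := composite N && (totient N %| N - 1).

(* Main.v *)
Require Import Defs.
From mathcomp Require Import all_boot.
From mathcomp Require Import all_order all_algebra finfield.
From mathcomp Require Import zify ring.

Set Implicit Arguments.
Unset Strict Implicit.
Unset Printing Implicit Defensive.

(** Suppose that N = L_n is composite and phi(N) divides N - 1.  Then N is odd
    and squarefree and 4 divides phi(N), which forces n to be odd, because
    L_n - 1 is never divisible by 4 for even n; moreover 3 does not divide n,
    because L_3 = 4.  For odd n one has L_n^2 - 1 = 5 F_(n+1) F_(n-1), which
    makes L_n - 1 accessible through divisibility of Fibonacci numbers.

    The heart of the proof is to look at a prime p dividing n.  If p^e divides
    L_n - 1 and p <> 5, then p^e divides one of F_(n+1), F_(n-1), whose index
    is prime to p; by the lifting property of Fibonacci numbers p^e must then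
    already divide F_(p-1) or F_(p+1), hence a Fibonacci or Lucas number of
    index at most (p+1)/2.  So p^e <= L_((p+1)/2) and e is at most about
    p / (2 log2 p) ([lucas_pfactor_bound]); for p = 5 one sees directly that
    e <= 1.  Since p^e divides phi(N) as soon as e primes of N are 1 modulo p,
    only that few primes q of N satisfy q = 1 mod p.

    Conversely, every prime q of N is 1 modulo some prime divisor of n
    ([prime_dvd_lucas_pred]): 5 is a square modulo q, so q divides F_(q-1), and
    q also divides F_(2n), so q - 1 and n have a common factor.  Finally, when
    p is the least prime factor of n, every prime r of n provides its own prime
    of N that is 1 modulo p, namely a prime of L_(pr) that is new with respect
    to L_p and L_r; hence the number of prime factors of n is bounded by the
    number of primes of N that are 1 modulo p ([lucas_omega_bound]).

    These facts make the sum of 1/q over the primes q of N small.  The primes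
    that are 1 modulo p are among the 2pj + 1, and there are fewer than
    2^t of them, with t the integer part of log2 p; so they contribute at most
    (1 + 1/2 + ... + 1/(2^t - 1)) / (2p) <= t / (2p).  Adding this over the few
    primes p of n gives a sum below 1/2 ([lehmer_lucas_sum_inv]), whence
    phi(N) > N/2.  A proper divisor of N - 1 cannot be that large, and phi(N)
    is a proper one because N is composite. *)

(** * Fibonacci and Lucas numbers *)

Fixpoint fib (n : nat) : nat :=
  match n with
  | 0 => 0
  | 1 => 1
  | (m.+1 as k).+1 => fib k + fib m
  end.

Lemma fibSS n : fib n.+2 = fib n.+1 + fib n. Proof. by []. Qed.

Lemma lucasSS n : lucas n.+2 = lucas n.+1 + lucas n. Proof. by []. Qed.

Lemma nat_ind2 (P : nat -> Prop) :
  P 0 -> P 1 -> (forall n, P n -> P n.+1 -> P n.+2) -> forall n, P n.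
Proof.
move=> P0 P1 PSS n; suff [] : P n /\ P n.+1 by [].
by elim: n => [|n [Pn PSn]]; split=> //; apply: PSS.
Qed.

Lemma lucas_fib n : lucas n + fib n = 2 * fib n.+1.
Proof.
elim/nat_ind2: n => // n; rewrite lucasSS !fibSS; lia.
Qed.

Lemma lucasS_fib n : lucas n.+1 = fib n + fib n.+2.
Proof. by have := lucas_fib n.+1; rewrite fibSS; lia. Qed.

Lemma fibD m n : fib (m + n).+1 = fib m.+1 * fib n.+1 + fib m * fib n.
Proof.
elim/nat_ind2: m => [||m IH0 IH1]; first by rewrite add0n /=; lia.
  by rewrite add1n fibSS /=; lia.
by rewrite !addSn fibSS -addSn IH1 IH0 !fibSS; ring.
Qed.

Lemma lucasD m n : lucas (m + n).+1 = fib m.+1 * lucas n.+1 + fib m * lucas n.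
Proof.
elim/nat_ind2: m => [||m IH0 IH1]; first by rewrite add0n /=; lia.
  by rewrite add1n lucasSS /=; lia.
by rewrite !addSn lucasSS -addSn IH1 IH0 !fibSS; ring.
Qed.

Lemma fib_gt0 n : 0 < n -> 0 < fib n.
Proof.
by case: n => // n _; elim/nat_ind2: n => // n _ IH; rewrite fibSS; lia.
Qed.

Lemma fib_double n : fib (2 * n) = fib n * lucas n.
Proof.
case: n => // n; have -> : 2 * n.+1 = (n + n.+1).+1 by lia.
by rewrite fibD lucasS_fib; ring.
Qed.

(** Cassini's identity F_(n+1)^2 - F_n F_(n+1) - F_n^2 = (-1)^n; the sign is
    spread over the two sides as parities to stay within natural numbers. *)
Lemma cassini n :
  fib n.+1 ^ 2 + odd n = fib n * fib n.+1 + fib n ^ 2 + ~~ odd n.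
Proof.
elim: n => // n; rewrite fibSS /= negbK -!mulnn.
by case: (odd n) => /=; nia.
Qed.

(** The identity L_n^2 - 5 F_n^2 = 4 (-1)^n.  It makes F_n invertible, and 5 a
    square for odd n, modulo the odd primes dividing L_n. *)
Lemma lucas_sqr n :
  lucas n ^ 2 + 4 * odd n = 5 * fib n ^ 2 + 4 * ~~ odd n.
Proof.
have lf := lucas_fib n; have := cassini n; rewrite -!mulnn.
have : (lucas n + fib n) * (lucas n + fib n) = 2 * fib n.+1 * (2 * fib n.+1).
  by rewrite lf.
have : (lucas n + fib n) * fib n = 2 * fib n.+1 * fib n by rewrite lf.
by case: (odd n) => /=; nia.
Qed.

Lemma lucas_gt0 n : 0 < lucas n.
Proof. by elim/nat_ind2: n => // n _ IH; rewrite lucasSS; lia. Qed.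

(** This replaces the factorizations of L_n - 1 itself, which depend on n
    modulo 4: a multiple of L_n - 1 is enough to bound the prime powers
    dividing it. *)
Lemma fib_neighbours n : odd n ->
  (lucas n - 1) * (lucas n + 1) = 5 * (fib n.+1 * fib n.-1).
Proof.
case: n => // n on; have := lucas_sqr n.+1; have := cassini n.+1.
have := lucas_gt0 n.+1; have := fibSS n.
rewrite on -!mulnn [n.+1.-1]/= => -> /=.
by set a := fib n; set b := fib n.+1; set c := lucas n.+1; nia.
Qed.

Lemma coprime_fibS n : coprime (fib n) (fib n.+1).
Proof.
elim: n => // n IH; rewrite fibSS coprime_sym /coprime gcdnC gcdnDl.
by rewrite gcdnC.
Qed.

(** Euclid's algorithm on the indices: by the addition formula and the
    coprimality of consecutive Fibonacci numbers, a divisor of F_m and F_n also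
    divides F_(n-m). *)
Lemma dvdn_fib_gcd d m n :
  d %| fib m -> d %| fib n -> d %| fib (gcdn m n).
Proof.
have [k] := ubnP (m + n); elim: k => // k IH in m n *;
  rewrite ltnS => mnk dm dn.
wlog lemn : m n mnk dm dn / m <= n => [W|].
  by case: (leqP m n) => [|/ltnW]/W; [|rewrite gcdnC]; apply; rewrite // addnC.
case: m => [|m] in mnk dm lemn *; first by rewrite gcd0n.
have nE : n = m.+1 + (n - m.+1) by lia.
rewrite nE gcdnDl; apply: IH => //; first by lia.
move: dn; rewrite {1}nE addSn fibD dvdn_addr; last by rewrite dvdn_mulr.
rewrite Gauss_dvdr //; apply: coprime_dvdl dm _.
by rewrite coprime_sym coprime_fibS.
Qed.

Lemma fib_dvd d n : d %| n -> fib d %| fib n.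
Proof.
case/dvdnP=> k ->; elim: k => // k IH; case: d IH => [|d] IH.
  by rewrite !muln0.
by rewrite mulSn addSn fibD; apply: dvdn_add;
  [apply: dvdn_mulr | apply: dvdn_mull].
Qed.

(** Increasing n by 2 shifts the index by 2d, which preserves divisibility by
    L_d because L_d divides F_(2d). *)
Lemma lucas_dvd d n : odd n -> lucas d %| lucas (n * d).
Proof.
move=> on; rewrite -[n]odd_double_half on -muln2 mulnC.
elim: n./2 => [|k IH]; first by rewrite muln1.
case: d IH => [|d] IH; first by rewrite !mul0n.
have -> : d.+1 * (1 + k.+1 * 2) = ((2 * d.+1).-1 + d.+1 * (1 + k * 2)).+1 by
  lia.
rewrite lucasD prednK // fib_double dvdn_add //; last by rewrite dvdn_mull.
by rewrite -mulnA mulnCA dvdn_mulr.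
Qed.

Lemma lucas_lt_exp n : 0 < n -> lucas n < 2 ^ n.
Proof.
case: n => // n _; elim/nat_ind2: n => // n IH0 IH1.
by rewrite lucasSS; have := expnS 2 n.+1; have := expnS 2 n.+2; lia.
Qed.

Lemma fib_le_lucas n : fib n <= lucas n.
Proof. by elim/nat_ind2: n => // n IH0 IH1; rewrite fibSS lucasSS leq_add. Qed.

Lemma lucas_le m n : 0 < m -> m <= n -> lucas m <= lucas n.
Proof.
move=> m0 /subnK <-; elim: (n - m) => // k IH.
case: m m0 IH => // m _; rewrite !addnS => IH; apply: leq_trans IH _.
by rewrite lucasSS leq_addr.
Qed.

Lemma lucas_mul_lt m n : 0 < n -> lucas m * lucas n < lucas (m + n + 3).
Proof.
move=> n0; rewrite addn3 -addSn -addSn lucasD.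
have := fib_gt0 (ltn0Sn m.+1); have := lucas_gt0 n.
have := lucas_le n0 (leqnSn n); have := lucas_fib m; rewrite !fibSS.
set a := fib m; set b := fib m.+1; set c := lucas m; set d := lucas n;
  set e := lucas n.+1.
move=> H1 H2 H3 H4.
have : c * d <= 2 * b * d by rewrite leq_mul2r; apply/orP; right; lia.
nia.
Qed.

(** * Prime powers dividing multiples of an index *)

(** With Q the Fibonacci matrix, Q^k = F_(k-1) + F_k Q; these are the entries of
    the binomial expansion of its (m+1)-st power, truncated modulo F_k and
    F_k^2 respectively. *)
Lemma fib_mul_expand k m : 0 < k -> exists x y,
  fib (m.+1 * k).+1 = fib k.-1 ^ m.+1 + x * fib k /\
  fib (m.+1 * k) = m.+1 * fib k.-1 ^ m * fib k + y * fib k ^ 2.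
Proof.
case: k => // k _; rewrite [k.+1.-1]/=; elim: m => [|m [x [y [E1 E2]]]].
  by exists 1, 0; rewrite !mul1n fibSS expn1; lia.
have -> : m.+2 * k.+1 = ((m.+1 * k.+1) + k).+1 by lia.
rewrite fibD E1 E2 -addnS fibD E1 E2 fibSS; set u := fib k; set f := fib k.+1.
exists (u ^ m.+1 + x * f + x * u + (m.+1 * u ^ m * f + y * f ^ 2)), (x + y * u).
by split; rewrite ?expnS; ring.
Qed.

(** In the expansion of F_(pk) along powers of F_k, the linear term carries a
    factor p, and F_k^2 is divisible by p^(2a). *)
Lemma fib_lift p a k : 0 < a -> 0 < k -> 0 < p ->
  p ^ a %| fib k -> p ^ a.+1 %| fib (p * k).
Proof.
case: p => // p a0 k0 _ pk; have [x [y [_ ->]]] := fib_mul_expand p k0.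
apply: dvdn_add; first by rewrite -mulnA expnS dvdn_mul // dvdn_mull.
apply: dvdn_mull; apply: (@dvdn_trans ((p.+1 ^ a) ^ 2));
  last by rewrite dvdn_exp2r.
by rewrite -expnM dvdn_exp2l // muln2 -addnn -addn1 leq_add2l.
Qed.

Lemma fib_lift_exp p e k : 0 < k -> 0 < p ->
  p %| fib k -> p ^ e.+1 %| fib (p ^ e * k).
Proof.
move=> k0 p0 pk; elim: e => [|e IH]; first by rewrite mul1n expn1.
by rewrite [p ^ e.+1]expnS -mulnA fib_lift // muln_gt0 expn_gt0 p0.
Qed.

(** * Lucas and Fibonacci numbers modulo a prime *)

Section GoldenRatio.
Import GRing.Theory.
Local Open Scope ring_scope.

Lemma golden_exprSS (R : nzRingType) (z : R) n :
  z ^+ 2 = z + 1 -> z ^+ n.+2 = z ^+ n.+1 + z ^+ n.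
Proof. by move=> z2; rewrite -addn2 exprD z2 mulrDr mulr1 -exprSr. Qed.

Lemma lucas_root (R : nzRingType) (x y : R) :
  x + y = 1 -> x ^+ 2 = x + 1 -> y ^+ 2 = y + 1 ->
  forall n, (lucas n)%:R = x ^+ n + y ^+ n.
Proof.
move=> xy x2 y2; elim/nat_ind2 => [||n IH0 IH1]; first by rewrite !expr0.
  by rewrite !expr1 xy.
by rewrite lucasSS natrD IH0 IH1 (golden_exprSS _ x2) (golden_exprSS _ y2)
  addrACA.
Qed.

(** In characteristic p the Frobenius map is additive on commuting elements.
    Applied to the two roots M and 1 - M of X^2 = X + 1 it gives
    L_p = M^p + (1 - M)^p = 1.  A companion matrix is used for the root M, so
    that no field extension has to be constructed. *)
Lemma lucas_prime p : prime p -> lucas p = 1 %[mod p].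
Proof.
move=> pp; pose M : 'M['F_p]_2 := \matrix_(i, j) ((i : nat) + j != 0)%N%:R.
have cp : p \in [pchar 'M['F_p]_2] by by rewrite pchar_lalg; exact: pchar_Fp.
have M2 : M ^+ 2 = M + 1.
  apply/matrixP=> i j; rewrite !mxE !big_ord_recl big_ord0 !mxE.
  by case: i => [[|[|]]] // ?; case: j => [[|[|]]] // ?; rewrite /=
    ?(mulr0, mulr1, mul0r, mul1r, addr0, add0r).
have N2 : (1 - M) ^+ 2 = (1 - M) + 1.
  rewrite expr2 mulrBr mulr1 mulrBl mul1r -expr2 M2.
  by rewrite opprB (addrC M) addrK.
have /(congr1 (pFrobenius_aut cp)) : M + (1 - M) = 1 by rewrite addrC subrK.
rewrite pFrobenius_autD_comm;
  last by rewrite /GRing.comm mulrBl mulrBr mul1r mulr1.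
rewrite pFrobenius_aut1 !pFrobenius_autE -(lucas_root _ M2 N2);
  last by rewrite addrC subrK.
move=> E; apply/eqP; rewrite eqn_mod_dvd ?lucas_gt0 //.
by rewrite (dvdn_pcharf cp) natrB ?lucas_gt0 // E subrr.
Qed.

Lemma binet (R : comNzRingType) (x y : R) :
  x + y = 1 -> x ^+ 2 = x + 1 -> y ^+ 2 = y + 1 ->
  forall n, (fib n)%:R * (x - y) = x ^+ n - y ^+ n.
Proof.
move=> xy x2 y2; elim/nat_ind2 => [||n IH0 IH1].
- by rewrite !expr0 mul0r subrr.
- by rewrite mul1r !expr1.
by rewrite fibSS natrD mulrDl IH0 IH1 (golden_exprSS _ x2) (golden_exprSS _ y2)
  opprD addrACA.
Qed.

(** Modulo q, 5 F_n^2 = 4, so 2 / F_n is a square root of 5 and both roots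
    1/2 + 1/F_n and 1/2 - 1/F_n of X^2 = X + 1 lie in the prime field.  By
    Fermat their (q-1)-st powers are 1, so Binet's formula gives F_(q-1) = 0. *)
Lemma prime_dvd_fib_pred q n :
  odd n -> prime q -> odd q -> (q %| lucas n)%N -> (q %| fib q.-1)%N.
Proof.
move=> on pq oq qL.
have cq := pchar_Fp pq.
have q0 (m : nat) : (m%:R == 0 :> 'F_q) = (q %| m)%N by rewrite (dvdn_pcharf
  cq).
have two0 : 2%:R != 0 :> 'F_q.
  by rewrite q0 dvdn_prime2 //; apply: contraL oq => /eqP->.
have [a aE] : exists a : 'F_q, a = (fib n)%:R by exists (fib n)%:R.
have a5 : 5%:R * a ^+ 2 = 2%:R ^+ 2.
  have /(congr1 (fun m => m%:R : 'F_q)) := lucas_sqr n;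
    rewrite on muln0 addn0 muln1.
  rewrite natrD natrM !natrX;
    have /eqP-> : (lucas n)%:R == 0 :> 'F_q by rewrite q0.
  by rewrite expr0n add0r -aE => <-; rewrite -natrX.
have a0 : a != 0.
  by apply: contraNneq two0 => a0; rewrite -sqrf_eq0 -a5 a0 expr0n mulr0.
pose x := 2%:R^-1 + a^-1; pose y := 2%:R^-1 - a^-1.
have xy : x + y = 1 by rewrite /x /y; field; rewrite a0.
have inv5 : a^-1 ^+ 2 = 5%:R / 2%:R ^+ 2.
  have five0 : 5%:R != 0 :> 'F_q.
    by apply: contraNneq two0 => five0; rewrite -sqrf_eq0 -a5 five0 mul0r.
  by rewrite -a5; field; rewrite a0 five0.
have four0 : 4%:R != 0 :> 'F_q by rewrite (natrM _ 2 2) mulf_neq0.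
have x2 : x ^+ 2 = x + 1.
  by rewrite /x sqrrD inv5; field; rewrite two0 a0 four0.
have y2 : y ^+ 2 = y + 1.
  by rewrite /y sqrrB inv5; field; rewrite two0 a0 four0.
have unit (z t : 'F_q) : z * t = - 1 -> z ^+ q.-1 = 1.
  move=> zt; have z0 : z != 0.
    by apply: contra_eq_neq zt => ->; rewrite mul0r eq_sym oppr_eq0 oner_eq0.
  apply: (mulfI z0); rewrite -exprS prednK ?prime_gt0 // mulr1.
  by have := expf_card z; rewrite card_Fp.
have xyN : x * y = - 1.
  by rewrite /x /y mulrC -subr_sqr inv5; field; rewrite four0.
have := binet xy x2 y2 q.-1; rewrite (unit x y) ?(unit y x) ?subrr //;
  last by rewrite mulrC.
move/eqP; rewrite mulf_eq0 q0 => /orP[//|].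
rewrite (_ : x - y = 2%:R / a) ?mulf_eq0 ?invr_eq0 ?(negPf two0) ?(negPf a0) //.
by rewrite /x /y; field; rewrite a0 two0.
Qed.
End GoldenRatio.

(** Since L_p = 1 mod p, the product L_p^2 - 1 = 5 F_(p+1) F_(p-1) vanishes
    modulo p. *)
Lemma prime_dvd_fib_neighbours p :
  prime p -> odd p -> p != 5 -> p %| fib p.+1 * fib p.-1.
Proof.
move=> pp op p5; have := fib_neighbours op.
have c5 : coprime p 5 by rewrite prime_coprime // dvdn_prime2.
rewrite -(Gauss_dvdr _ c5) => <-; apply: dvdn_mulr.
by rewrite -eqn_mod_dvd ?lucas_gt0 //; apply/eqP; apply: lucas_prime.
Qed.

Lemma odd_prime_dvd_lucas_fib q n :
  prime q -> odd q -> q %| lucas n -> ~~ (q %| fib n).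
Proof.
move=> pq oq qL; apply/negP=> qF; have := lucas_sqr n.
have q4 : ~~ (q %| 4).
  rewrite (_ : 4 = 2 ^ 2) // Euclid_dvdX // andbT dvdn_prime2 //.
  by apply: contraL oq => /eqP->.
case: (odd n) => /= /(congr1 (dvdn q)).
  rewrite muln1 muln0 addn0 dvdn_addr ?(negPf q4); last by rewrite dvdn_exp.
  by rewrite dvdn_mull // dvdn_exp.
rewrite muln1 muln0 addn0 [in RHS]dvdn_addr ?(negPf q4);
  last by rewrite dvdn_mull // dvdn_exp.
by rewrite dvdn_exp.
Qed.

(** F_(2b) = F_b L_b, and q cannot divide F_b, which divides F_n. *)
Lemma lucas_descent q n b :
  prime q -> odd q -> q %| lucas n -> b %| n -> q %| fib (2 * b) -> q %| lucas
    b.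
Proof.
move=> pq oq qL bn; rewrite fib_double Euclid_dvdM // => /orP[qF|//].
by have := odd_prime_dvd_lucas_fib pq oq qL; rewrite (dvdn_trans qF) // fib_dvd.
Qed.

Lemma prime_dvd_lucas_gcd q m n :
  prime q -> odd q -> q %| lucas m -> q %| lucas n -> q %| lucas (gcdn m n).
Proof.
move=> pq oq qm qn; apply: (lucas_descent pq oq qm); first exact: dvdn_gcdl.
by rewrite muln_gcdr dvdn_fib_gcd // fib_double dvdn_mull.
Qed.

(** * The power of a prime divisor of the index in L_n - 1 *)

(** Taking binary logarithms of p^e <= L_h < 2^h with h = (p+1)/2. *)
Lemma trunc_log_le_half p e : 1 < p -> p ^ e <= lucas (p./2).+1 ->
  trunc_log 2 p * e <= p./2.
Proof.
move=> p1 H; rewrite -ltnS -(ltn_exp2l _ _ (ltnSn 1)).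
apply: leq_ltn_trans (lucas_lt_exp (ltn0Sn _)); apply: leq_trans H.
by rewrite expnM; case: e => // e; rewrite leq_exp2r // trunc_logP // ltnW.
Qed.

(** p^e divides both F_m and F_(p^(e-1) k), hence the Fibonacci number whose
    index is their gcd; as p does not divide m, this gcd divides k. *)
Lemma pfactor_fib_descent p e m k :
  prime p -> coprime p m -> 0 < k -> p %| fib k ->
  p ^ e %| fib m -> p ^ e %| fib k.
Proof.
move=> pp cpm k0 pk; case: e => [|e] pm; first by rewrite dvd1n.
apply: dvdn_trans (fib_dvd (dvdn_gcdr m k)).
have := dvdn_fib_gcd pm (fib_lift_exp e k0 (prime_gt0 pp) pk).
by rewrite Gauss_gcdr // coprime_sym coprimeXl.
Qed.

(** As p divides n, it divides neither n + 1 nor n - 1, so [pfactor_fib_descent]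
    sends p^e down to F_(p-1) or F_(p+1).  These indices are even, and p divides
    only one factor of F_(2h) = F_h L_h, which halves the exponent in the
    resulting bound. *)
Lemma lucas_pfactor_bound p n e :
  prime p -> 5 <= p -> odd n -> p %| n -> p ^ e %| lucas n - 1 ->
  trunc_log 2 p * e <= p./2.
Proof.
move=> pp p5 on pn pe.
have op : odd p by case: (even_prime pp) p5 => [->|].
have n0 : 0 < n by case: n on {pn pe}.
have := dvdn_trans pe (dvdn_mulr (lucas n + 1) (dvdnn _)).
rewrite fib_neighbours // => {}pe.
have cop m : m = n.+1 \/ m = n.-1 -> coprime p m.
  move=> mn; rewrite prime_coprime //; apply/negP=> pm.
  have : p %| 1.
    case: mn pm => -> pm; first by rewrite -(dvdn_addr _ pn) addn1.
    by rewrite -(dvdn_addr _ pm) addn1 prednK.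
  by rewrite dvdn1; apply/negP; move: (prime_gt1 pp);
    case: p {pp p5 pn pe op pm} => [|[]].
have [p5E|p5N] := eqVneq p 5.
  (* Here 25 cannot divide 5 F_(n+1) F_(n-1): as 5 divides F_5, a Fibonacci
     number divisible by 5 has an index divisible by 5. *)
  subst p; rewrite (_ : trunc_log 2 5 = 2) //.
  case: e pe => [|[|e]] //; rewrite expnS dvdn_pmul2l // => pe.
  have : 5 %| fib n.+1 * fib n.-1 by apply: dvdn_trans pe; apply: dvdn_exp.
  have no m : m = n.+1 \/ m = n.-1 -> 5 %| fib m -> false.
    move=> /cop c5m /(dvdn_fib_gcd (isT : 5 %| fib 5)).
    by rewrite (eqP c5m).
  by rewrite Euclid_dvdM // => /orP[/(no _ (or_introl erefl))|
    /(no _ (or_intror erefl))].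
have c5 : coprime (p ^ e) 5 by rewrite coprimeXl // prime_coprime //
  dvdn_prime2.
have {pe} [m [cm pm]] : exists m, coprime p m /\ p ^ e %| fib m.
  move: pe; rewrite Gauss_dvdr //.
  have [pF|pF] := boolP (p %| fib n.+1); last first.
    rewrite Gauss_dvdr ?coprimeXl ?prime_coprime // => pe.
    by exists n.-1; split; first by apply: cop; right.
  rewrite Gauss_dvdl => [pe|]; first by exists n.+1; split;
    first by apply: cop; left.
  rewrite coprimeXl // prime_coprime //; apply/negP=> pF'.
  have := dvdn_fib_gcd pF pF'; apply/negP.
  have : gcdn n.+1 n.-1 %| 2.
    by rewrite gcdnC (_ : n.+1 = n.-1 + 2) ?gcdnDl ?dvdn_gcdr //; lia.
  rewrite dvdn_divisors // => /predU1P[->|/predU1P[->|//]];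
  by rewrite dvdn1; apply/eqP=> p1; rewrite p1 in pp.
have h2 : p = (2 * p./2).+1 by rewrite mul2n -[LHS]odd_double_half op.
have h0 : 0 < p./2 by lia.
have two k : p %| fib (2 * k) -> 0 < k -> k <= (p./2).+1 ->
  trunc_log 2 p * e <= p./2.
  move=> pk k0 kh; apply: trunc_log_le_half (prime_gt1 pp) _;
    apply: leq_trans (lucas_le k0 kh).
  have := pfactor_fib_descent pp cm _ pk pm; rewrite muln_gt0 k0 => /(_ isT).
  rewrite fib_double; have [pL|pL] := boolP (p %| lucas k).
    rewrite Gauss_dvdr ?coprimeXl ?prime_coprime ?(odd_prime_dvd_lucas_fib pp
      op pL) //.
    by move/dvdn_leq; apply; rewrite lucas_gt0.
  rewrite Gauss_dvdl ?coprimeXl ?prime_coprime // => /dvdn_leq -/(_ (fib_gt0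
    k0)).
  by move/leq_trans; apply; apply: fib_le_lucas.
have := prime_dvd_fib_neighbours pp op p5N; rewrite Euclid_dvdM // => /orP[].
  by rewrite (_ : p.+1 = 2 * (p./2).+1) => [/two|]; [apply | lia].
by rewrite (_ : p.-1 = 2 * p./2) => [/two|]; [apply | lia].
Qed.

(** * Prime divisors of odd-indexed Lucas numbers *)

(** q divides F_(q-1) and F_(2n), so it divides F_(2g) for g the gcd of
    (q-1)/2 and n, and then it divides L_g. *)
Lemma prime_dvd_lucas_rank q n :
  odd n -> prime q -> odd q -> q %| lucas n -> q %| lucas (gcdn q./2 n).
Proof.
move=> on pq oq qL; apply: (lucas_descent pq oq qL); first exact: dvdn_gcdr.
rewrite muln_gcdr dvdn_fib_gcd //; last by rewrite fib_double dvdn_mull.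
have -> : 2 * q./2 = q.-1 by rewrite mul2n -[q in RHS]odd_double_half oq.
exact: prime_dvd_fib_pred on pq oq qL.
Qed.

Lemma dvdn_half_pred p q : odd p -> odd q -> (p %| q./2) = (p %| q.-1).
Proof.
move=> op oq; rewrite -[q in RHS]odd_double_half oq /= -mul2n Gauss_dvdr //.
by rewrite coprimen2.
Qed.

(** The gcd of (q-1)/2 and n is not 1, because L_1 = 1. *)
Lemma prime_dvd_lucas_pred q n :
  odd n -> prime q -> odd q -> q %| lucas n ->
  exists2 p, p \in primes n & p %| q.-1.
Proof.
move=> on pq oq qL; have := prime_dvd_lucas_rank on pq oq qL.
have n0 : 0 < n by case: n on {qL}.
set g := gcdn _ _; have [->|g1] := eqVneq g 1.
  by rewrite dvdn1 => /eqP q1; rewrite q1 in pq.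
have g0 : 0 < g by rewrite gcdn_gt0 n0 orbT.
move=> _; exists (pdiv g).
  by rewrite mem_primes n0 (dvdn_trans (pdiv_dvd _)) ?dvdn_gcdr // pdiv_prime
    //; lia.
rewrite -dvdn_half_pred //;
  first by apply: dvdn_trans (pdiv_dvd _) (dvdn_gcdl _ _).
by apply: dvdn_odd on; apply: dvdn_trans (pdiv_dvd _) (dvdn_gcdr _ _).
Qed.

(** * Squarefree numbers and totients *)

Definition squarefree N := forall q, prime q -> ~~ (q ^ 2 %| N).

Lemma squarefree_dvdn M N : 0 < M -> squarefree M ->
  (forall q, prime q -> q %| M -> q %| N) -> M %| N.
Proof.
move=> M0 sfM MN; apply/dvdn_partP => // q;
  rewrite mem_primes => /and3P[pq _ qM].
rewrite p_part; apply: dvdn_trans (MN q pq qM);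
  rewrite -[X in _ %| X]expn1 dvdn_exp2l //.
by rewrite leqNgt -pfactor_dvdn // sfM.
Qed.

Lemma totient_squarefree N : 0 < N -> squarefree N ->
  totient N = \prod_(q <- primes N) q.-1.
Proof.
move=> N0 sf; rewrite totientE //; apply: eq_big_seq => q;
  rewrite mem_primes => /and3P[pq _ qN].
rewrite (_ : logn q N = 1) ?muln1 //; apply/eqP;
  rewrite eqn_leq logn_gt0 mem_primes pq N0 qN andbT.
by rewrite leqNgt -pfactor_dvdn // sf.
Qed.

Lemma squarefree_prod N : 0 < N -> squarefree N ->
  N = \prod_(q <- primes N) q.
Proof.
move=> N0 sf; rewrite {1}(prod_prime_decomp N0) prime_decompE big_map.
apply: eq_big_seq => q; rewrite mem_primes => /and3P[pq _ qN] /=.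
rewrite (_ : logn q N = 1) ?expn1 //; apply/eqP;
  rewrite eqn_leq logn_gt0 mem_primes pq N0 qN andbT.
by rewrite leqNgt -pfactor_dvdn // sf.
Qed.

(** If q^2 divides N then q divides both phi(N) and N. *)
Lemma lehmer_squarefree N : 0 < N -> totient N %| N - 1 -> squarefree N.
Proof.
move=> N0 tN q pq; apply/negP=> q2.
have qN : q \in primes N by rewrite mem_primes pq N0 (dvdn_trans _ q2) //
  dvdn_exp.
have : q %| N - 1.
  apply: dvdn_trans tN; rewrite totientE // (big_rem q) //= dvdn_mulr //
    dvdn_mull //.
  by rewrite dvdn_exp // -subn1 subn_gt0 -pfactor_dvdn.
rewrite -(dvdn_subr _ (dvdn_trans _ q2)) ?subKn ?leq_subr // ?dvdn1 ?dvdn_exp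
  //.
by move/eqP=> q1; rewrite q1 in pq.
Qed.

Lemma totient_composite N : composite N -> totient N < N - 1.
Proof.
case/andP=> N1 NP; rewrite totient_count_coprime big_ltn; last by apply: ltnW.
rewrite /coprime gcdn0 (gtn_eqF N1) add0n.
have pN : pdiv N < N.
  rewrite ltn_neqAle pdiv_leq ?(ltnW N1) // andbT.
  by apply: contraNneq NP => <-; apply: pdiv_prime.
have pin : pdiv N \in index_iota 1 N by rewrite mem_index_iota pdiv_gt0.
rewrite -[ltnRHS]muln1 -sum_nat_const_nat !(bigD1_seq (pdiv N)) ?iota_uniq //=.
have /gcdn_idPr-> := pdiv_dvd N; rewrite (gtn_eqF (prime_gt1 (pdiv_prime N1))).
by rewrite add0n add1n ltnS; apply: leq_sum => d _; apply: leq_b1.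
Qed.

Lemma count_dvdn_prod p (s : seq nat) :
  p ^ count (fun q => p %| q.-1) s %| \prod_(q <- s) q.-1.
Proof.
elim: s => [|q s IH]; first by rewrite big_nil.
rewrite big_cons /= expnD dvdn_mul //; by case: (boolP (p %| q.-1)) => // _;
  rewrite dvd1n.
Qed.

(** An even squarefree composite number has an odd prime factor, so its totient
    is even and cannot divide an odd number. *)
Lemma lehmer_odd N : lehmer N -> odd N.
Proof.
case/andP=> /andP[N1 NP] tN; have N0 := ltnW N1;
  have sf := lehmer_squarefree N0 tN.
apply: contraT => eN.
have [M NE] : exists M, N = 2 * M by exists N./2; rewrite mul2n even_halfK.
have M1 : 1 < M by move: NE NP N1; case: M => [|[|m]] // ->.
have oM : odd M.
  by apply: contraT => eM; have := sf 2 isT; rewrite NE dvdn_pmul2l // dvdn2 eM.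
have qM := pdiv_dvd M; have pq := pdiv_prime M1.
have qN : pdiv M \in primes N by rewrite mem_primes pq N0 NE dvdn_mull.
have : 2 %| N - 1.
  apply: dvdn_trans tN; rewrite totient_squarefree // (big_rem _ qN) /=
    dvdn_mulr //.
  by rewrite dvdn2 -oddS prednK ?prime_gt0 // (dvdn_odd qM).
by rewrite dvdn2 oddB // (negPf eN).
Qed.

Lemma four_dvdn_totient N : composite N -> odd N -> squarefree N -> 4 %|
  totient N.
Proof.
case/andP=> N1 NP oN sf; have N0 := ltnW N1.
rewrite totient_squarefree //; apply: dvdn_trans (count_dvdn_prod 2 _).
have -> : count (fun q => 2 %| q.-1) (primes N) = size (primes N).
  apply/eqP; rewrite -all_count; apply/allP=> q;
    rewrite mem_primes => /and3P[pq _ qN].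
  by rewrite dvdn2 -oddS prednK ?prime_gt0 // (dvdn_odd qN).
rewrite (dvdn_exp2l 2 (_ : 2 <= _)) //.
have pr q : q \in primes N -> prime q by rewrite mem_primes => /andP[].
move: (squarefree_prod N0 sf) pr N1 NP; case: (primes N) => [|q [|q' s]] //.
  by rewrite big_nil => ->.
by rewrite big_seq1 => -> pr _; rewrite pr ?mem_head.
Qed.

(** * Primes of a Lucas number that are 1 modulo a prime divisor of the index *)

(** Otherwise the squarefree number L_(pr) would divide L_p L_r, which is
    smaller.  Squarefreeness is what makes this cheap substitute for the theory
    of primitive divisors possible. *)
Lemma lucas_mul_new_prime p r : prime p -> prime r -> p != r -> 2 < p -> 2 < r
  ->
  squarefree (lucas (p * r)) ->
  exists q, [/\ prime q, q %| lucas (p * r), ~~ (q %| lucas p)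
    & ~~ (q %| lucas r)].
Proof.
move=> pp pr pNr p2 r2 sf.
case: (boolP (all (fun q => (q %| lucas p) || (q %| lucas r)) (primes (lucas (p
  * r))))).
  move/allP=> H; have : lucas (p * r) %| lucas p * lucas r.
    apply: squarefree_dvdn (lucas_gt0 _) sf _ => q pq qL;
      rewrite Euclid_dvdM //.
    by apply: H; rewrite mem_primes pq lucas_gt0.
  move/dvdn_leq; rewrite muln_gt0 !lucas_gt0 => /(_ isT);
    rewrite leqNgt => /negP[].
  apply: leq_trans (lucas_mul_lt _ (ltnW (ltnW r2))) (lucas_le _ _);
    first by rewrite addn3.
  by move/eqP: pNr; nia.
rewrite -has_predC => /hasP[q];
  rewrite mem_primes => /and3P[pq _ qL] /= /norP[H1 H2].
by exists q.
Qed.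

(** If p did not divide (q-1)/2, then gcd ((q-1)/2, pr) would divide r and q
    would divide L_r. *)
Lemma lucas_mul_new_prime_pred p r q : prime p -> odd p -> odd r ->
  prime q -> odd q -> q %| lucas (p * r) -> ~~ (q %| lucas r) -> p %| q.-1.
Proof.
move=> pp op or pq oq qL qr; rewrite -dvdn_half_pred //.
have := prime_dvd_lucas_rank _ pq oq qL; rewrite oddM op or => /(_ isT) H.
apply: contraR qr => pN; rewrite Gauss_gcdr in H;
  last by rewrite coprime_sym prime_coprime.
apply: dvdn_trans H _; have /dvdnP[k kE] := dvdn_gcdr q./2 r.
rewrite {2}kE; apply: lucas_dvd; move: or; rewrite kE oddM; by case/andP.
Qed.

(** To each prime r <> p of n is attached a prime of L_(pr) dividing neither
    L_p nor L_r, and to p itself a prime of L_p.  All of them are 1 modulo p.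
    They are distinct: a common prime for r <> r' would divide L_g with
    g = gcd (pr, pr') = p, which is excluded. *)
Lemma lucas_omega_bound n p : odd n -> odd (lucas n) -> squarefree (lucas n) ->
  (forall r, r \in primes n -> 2 < r) -> p \in primes n ->
  size (primes n) <= count (fun q => p %| q.-1) (primes (lucas n)).
Proof.
move=> on oL sf pr2 pn; have [pp n0 pdn] : [/\ prime p, 0 < n & p %| n].
  by move: pn; rewrite mem_primes => /and3P.
have op := dvdn_odd pdn on.
pose good r q := (q %| lucas (p * r)) && ~~ (q %| lucas p).
pose test r q := if r == p then q %| lucas p else good r q.
have sub d q : d %| n -> prime q -> q %| lucas d -> q \in primes (lucas n)
  /\ odd q.
  move=> dn pq qd; have qn : q %| lucas n.
    apply: dvdn_trans qd _; case/dvdnP: dn => k nE; rewrite nE;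
      apply: lucas_dvd.
    by move: on; rewrite nE oddM => /andP[].
  by rewrite mem_primes pq lucas_gt0 qn; split=> //; apply: dvdn_odd qn oL.
have ex r : r \in primes n -> exists q, [/\ q \in primes (lucas n), p %| q.-1 &
  test r q].
  move=> rn; rewrite /test; have [rp|rNp] := eqVneq r p.
    have Lp1 : 1 < lucas p.
      by apply: leq_trans (lucas_le (isT : 0 < 2) (prime_gt1 pp)).
    exists (pdiv (lucas p)); have [qn oq] := sub p _ pdn (pdiv_prime Lp1)
      (pdiv_dvd _).
    split; rewrite ?pdiv_dvd //.
    have [p' ] := prime_dvd_lucas_pred op (pdiv_prime Lp1) oq (pdiv_dvd _).
    by rewrite primes_prime // inE => /eqP->.
  have [pr _ rdn] : [/\ prime r, 0 < n & r %| n].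
    by move: rn; rewrite mem_primes => /and3P.
  have prn : p * r %| n.
    by rewrite Gauss_dvd ?pdn ?rdn // prime_coprime // dvdn_prime2 // eq_sym.
  have sfpr : squarefree (lucas (p * r)).
    move=> q pq; apply: contra (sf q pq) => H; apply: dvdn_trans H _.
    case/dvdnP: prn => k nE; rewrite nE; apply: lucas_dvd.
    by move: on; rewrite nE oddM => /andP[].
  have [|||q [pq q1 q2 q3]] := lucas_mul_new_prime pp pr _ _ _ sfpr;
    rewrite 1?eq_sym ?pr2 //.
  have [qn oq] := sub _ _ prn pq q1.
  exists q; split=> //; last by rewrite /good q1 q2.
  by apply: lucas_mul_new_prime_pred q1 q3 => //; apply: dvdn_odd rdn on.
(* The value chosen for r is the first prime of L_n with the required
   properties. *)
pose f r := nth 0 (primes (lucas n)) (find (fun q => (p %| q.-1) && test r q)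
  (primes (lucas n))).
have fP r : r \in primes n -> [/\ f r \in primes (lucas n), p %| (f r).-1 &
  test r (f r)].
  move=> /ex[q [qn pq tq]].
  have H : has (fun q => (p %| q.-1) && test r q) (primes (lucas n)).
    by apply/hasP; exists q => //; apply/andP.
  by have /andP[] := nth_find 0 H; split=> //; rewrite mem_nth // -has_find.
rewrite -size_filter -(size_map f); apply: uniq_leq_size; last first.
  by move=> q /mapP[r rn ->]; have [H1 H2 _] := fP r rn; rewrite mem_filter H2.
rewrite map_inj_in_uniq ?primes_uniq // => r r' rn rn' E.
have [fn _ T] := fP r rn; have [_ _] := fP r' rn'; rewrite -E => T'.
have [pf fL] : prime (f r) /\ f r %| lucas n by move: fn;
  rewrite mem_primes => /and3P[].
have of_ : odd (f r) := dvdn_odd fL oL.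
have [pr _ rdn] : [/\ prime r, 0 < n & r %| n].
  by move: rn; rewrite mem_primes => /and3P.
have [pr' _ rdn'] : [/\ prime r', 0 < n & r' %| n].
  by move: rn'; rewrite mem_primes => /and3P.
move: T T'; rewrite /test /good.
have [->|rp] := eqVneq r p; have [->|rp'] := eqVneq r' p => //.
- by move=> ->; rewrite andbF.
- by move=> /andP[_ /negPf->].
move=> /andP[T1 T2] /andP[T1' _]; apply/eqP; apply: contraR T2 => rr'.
have := prime_dvd_lucas_gcd pf of_ T1 T1'; rewrite -muln_gcdr.
have /eqP-> : coprime r r' by rewrite prime_coprime // dvdn_prime2.
by rewrite muln1.
Qed.

(** * Sums of reciprocals *)

(** The function log2 p / p decreases; with truncated logarithms this survives
    at the cost of one unit: if log2 p' exceeds log2 p + 1 by j, then p' exceeds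
    p by a factor 2^j > j. *)
Lemma trunc_log_ratio p p' : 0 < p -> p <= p' ->
  trunc_log 2 p' * p <= (trunc_log 2 p).+1 * p'.
Proof.
move=> p0 pp'; have [le|lt] := leqP (trunc_log 2 p') (trunc_log 2 p).+1.
  exact: leq_mul.
have := trunc_logP (ltnSn 1) (leq_trans p0 pp').
have := trunc_log_ltn p (ltnSn 1).
set t := (trunc_log 2 p).+1 in lt *; have t0 : 0 < t by [].
rewrite -(subnK (ltnW lt)) expnD; set j := trunc_log 2 p' - t.
have jB : j < 2 ^ j := ltn_expl j (ltnSn 1).
move=> pA Bp'; apply: (@leq_trans (t * (2 ^ j * 2 ^ t)));
  last by rewrite leq_mul2l Bp' orbT.
rewrite mulnA; apply: leq_mul; last exact: ltnW.
apply: (@leq_trans (t * j.+1)); last by rewrite leq_mul2l jB orbT.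
by rewrite mulnS addnC leq_add2l leq_pmull.
Qed.

Section Reciprocals.
Import Order.TTheory GRing.Theory Num.Theory.
Local Open Scope ring_scope.

(** Dyadic blocks of the harmonic series: the 2^t terms from 1/2^t on add up
    to at most 1. *)
Lemma sum_inv_iota t : \sum_(1 <= i < 2 ^ t) (i%:R : rat)^-1 <= t%:R.
Proof.
elim: t => [|t IH]; first by rewrite big_geq.
rewrite (@big_cat_nat _ _ _ (2 ^ t)%N) /= ?expn_gt0 ?leq_exp2l // -[t.+1]addn1
  natrD lerD //.
apply: (@le_trans _ _ (\sum_(2 ^ t <= i < 2 ^ (t + 1)) ((2 ^ t)%:R : rat)^-1)).
  rewrite big_nat [leRHS]big_nat; apply: ler_sum => i /andP[ti _].
  by rewrite lef_pV2 ?posrE ?ltr0n ?expn_gt0 ?ler_nat // (leq_trans _ ti)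
    ?expn_gt0.
rewrite big_const_nat iter_addr addr0 addn1 expnS mul2n -addnn addnK
  -[leLHS]mulr_natr mulVf //.
by rewrite pnatr_eq0 -lt0n expn_gt0.
Qed.

(** By induction, removing an element of s that is at least its size; there is
    one by the pigeonhole principle. *)
Lemma sum_inv_uniq (s : seq nat) : uniq s -> all (leq 1) s ->
  \sum_(j <- s) (j%:R : rat)^-1 <= \sum_(1 <= i < (size s).+1) (i%:R : rat)^-1.
Proof.
move: {2}(size s) (erefl (size s)) => m; elim: m s => [|m IH] s sm us ps.
  by case: s sm {us ps} => // _; rewrite big_nil big_geq.
have [x xs xm] : exists2 x, x \in s & (m < x)%N.
  apply/hasP; apply: contraT => /hasPn sm'.
  have : (size s <= size (iota 1 m))%N.
    apply: uniq_leq_size us _ => x xs;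
      rewrite mem_iota (allP ps) //= add1n ltnS leqNgt.
    exact: sm'.
  by rewrite size_iota sm ltnn.
rewrite (perm_big _ (perm_to_rem xs)) big_cons sm big_nat_recr //= addrC lerD
  //.
  have := IH (rem x s); rewrite size_rem // sm; apply=> //;
    first exact: rem_uniq.
  by apply/allP=> y /mem_rem /(allP ps).
by rewrite lef_pV2 ?posrE ?ltr0n ?ler_nat //; apply: leq_ltn_trans xm.
Qed.

Lemma sum_inv_lt_exp t (s : seq nat) : uniq s -> all (leq 1) s -> (size s < 2 ^
  t)%N ->
  \sum_(j <- s) (j%:R : rat)^-1 <= t%:R.
Proof.
move=> us ps st; apply: le_trans (sum_inv_uniq us ps) _;
  apply: le_trans (sum_inv_iota t).
rewrite [leRHS](@big_cat_nat _ _ _ (size s).+1) //= lerDl sumr_ge0 // => i _.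
by rewrite invr_ge0 ler0n.
Qed.

(** Each such q is 2pj + 1 for some j > 0, and the j are distinct. *)
Lemma sum_inv_mod1 p (s : seq nat) t : odd p -> uniq s ->
  (forall q, q \in s -> odd q && (1 < q)%N) ->
  (count (fun q => p %| q.-1)%N s < 2 ^ t)%N ->
  \sum_(q <- s | (p %| q.-1)%N) (q%:R : rat)^-1 <= t%:R / (2 * p)%:R.
Proof.
move=> op us ps ct; have p0 : (0 < p)%N by case: p op {ct}.
pose d q := (q.-1 %/ (2 * p))%N; pose u := [seq q <- s | (p %| q.-1)%N].
have dE q : q \in u -> q = (d q * (2 * p)).+1 /\ (0 < d q)%N.
  rewrite mem_filter => /andP[pq /ps/andP[oq q1]].
  have H : (2 * p %| q.-1)%N.
    by rewrite Gauss_dvd ?coprime2n // pq andbT dvdn2 -oddS prednK // ltnW.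
  split; first by rewrite /d divnK // prednK // ltnW.
  by rewrite divn_gt0 ?muln_gt0 // dvdn_leq // -subn1 subn_gt0.
rewrite -big_filter -/u.
have -> : t%:R / (2 * p)%:R = (2 * p)%:R^-1 * t%:R :> rat by rewrite mulrC.
apply: (@le_trans _ _ ((2 * p)%:R^-1 * \sum_(j <- map d u) (j%:R : rat)^-1));
  last first.
  rewrite ler_wpM2l ?invr_ge0 ?ler0n //; apply: sum_inv_lt_exp.
  - rewrite map_inj_in_uniq ?filter_uniq // => q q' /dE[E _] /dE[E' _] dd.
    by rewrite E E' dd.
  - by apply/allP=> j /mapP[q /dE[_ dq] ->].
  - by rewrite size_map size_filter.
rewrite big_map mulr_sumr big_seq [leRHS]big_seq; apply: ler_sum => q /dE[E dq].
rewrite -invfM -natrM lef_pV2 ?posrE ?ltr0n ?muln_gt0 ?dq ?p0 ?ler_nat //.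
  by rewrite mulnC {2}E.
by rewrite E.
Qed.

(** The Weierstrass inequality prod (1 - 1/q) >= 1 - sum 1/q, with
    denominators cleared. *)
Lemma prod_pred_ge (s : seq nat) : all (leq 1) s ->
  (\prod_(q <- s) q)%:R * (1 - \sum_(q <- s) (q%:R : rat)^-1) <= (\prod_(q <-
    s) q.-1)%:R.
Proof.
elim: s => [|q s IH]; first by rewrite !big_nil subr0.
rewrite /= => /andP[q0 ps]; rewrite !big_cons !natrM.
set P := (\prod_(j <- s) j)%N; set S := \sum_(j <- s) _.
apply: (@le_trans _ _ (q.-1%:R * (P%:R * (1 - S))));
  last by rewrite ler_wpM2l ?ler0n ?IH.
have qn0 : (q%:R : rat) != 0 by rewrite pnatr_eq0 -lt0n.
have S0 : 0 <= S by apply: sumr_ge0 => j _; rewrite invr_ge0 ler0n.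
have P0 : (0 : rat) <= P%:R by rewrite ler0n.
rewrite -subn1 natrB // -subr_ge0.
have -> : (q%:R - 1) * (P%:R * (1 - S)) - q%:R * P%:R * (1 - (q%:R^-1 + S)) =
  P%:R * S :> rat.
  by field; rewrite qn0.
exact: mulr_ge0.
Qed.

End Reciprocals.

(** * Lehmer numbers among the Lucas numbers *)

(** Modulo 4, the pairs (L_(2k), L_(2k+1)) run through (2,1), (3,0), (3,3). *)
Lemma lucas_even_mod4 k : lucas (2 * k) %% 4 \in [:: 2; 3].
Proof.
suff: (lucas (2 * k) %% 4, lucas (2 * k).+1 %% 4) \in [:: (2, 1); (3, 0);
  (3, 3)].
  by rewrite !inE => /or3P[] /eqP[-> _].
elim: k => // k; rewrite mulnS add2n !lucasSS; set a := lucas _;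
  set b := lucas _; rewrite !inE.
by move=> /or3P[] /eqP[H1 H2]; apply/or3P;
  [constructor 2|constructor 3|constructor 1];
 apply/eqP; congr pair; lia.
Qed.

Lemma lehmer_lucas_odd_index n : lehmer (lucas n) -> odd n.
Proof.
move=> lL; have oL := lehmer_odd lL; case/andP: lL => cL tL.
have := dvdn_trans (four_dvdn_totient cL oL (lehmer_squarefree (lucas_gt0 n)
  tL)) tL.
apply: contraTT => en; rewrite -eqn_mod_dvd ?lucas_gt0 //.
have := lucas_even_mod4 n./2; rewrite mul2n even_halfK // !inE.
by case/orP=> /eqP->.
Qed.

Lemma lucas_index_prime_ge5 n p : odd n -> odd (lucas n) -> p \in primes n -> 5
  <= p.
Proof.
move=> on oL; rewrite mem_primes => /and3P[pp n0 pn].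
have op := dvdn_odd pn on.
have pN3 : p != 3.
  apply: contraL oL => /eqP pE; move: pn; rewrite pE => /dvdnP[k nE].
  suff: 2 %| lucas n by rewrite dvdn2.
  apply: (@dvdn_trans (lucas 3)) => //; rewrite nE; apply: lucas_dvd.
  by move: on; rewrite nE oddM => /andP[].
by case: p pp op pN3 {pn} => [|[|[|[|[|]]]]].
Qed.

(** If c primes of L_n are 1 modulo p, then p^c divides phi(L_n), hence
    L_n - 1. *)
Lemma lehmer_lucas_count n p : lehmer (lucas n) -> p \in primes n ->
  trunc_log 2 p * count (fun q => p %| q.-1) (primes (lucas n)) <= p./2.
Proof.
move=> lL pn; have on := lehmer_lucas_odd_index lL; have oL := lehmer_odd lL.
have p5 := lucas_index_prime_ge5 on oL pn; move: pn;
  rewrite mem_primes => /and3P[pp _ pdn].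
case/andP: lL => _ tL; apply: (lucas_pfactor_bound pp p5 on pdn).
apply: dvdn_trans (count_dvdn_prod _ _) _.
rewrite -totient_squarefree ?lucas_gt0 //;
  exact: lehmer_squarefree (lucas_gt0 n) tL.
Qed.

Section Estimate.
Import Order.TTheory GRing.Theory Num.Theory.
Local Open Scope ring_scope.

Lemma sum_inv_primes_lucas n : odd n -> odd (lucas n) ->
  \sum_(q <- primes (lucas n)) (q%:R : rat)^-1 <=
  \sum_(p <- primes n) \sum_(q <- primes (lucas n) | (p %| q.-1)%N) q%:R^-1.
Proof.
move=> on oL; rewrite (exchange_big_dep xpredT) //= big_seq [leRHS]big_seq.
apply: ler_sum => q; rewrite mem_primes => /and3P[pq _ qL].
have [p pn pq1] := prime_dvd_lucas_pred on pq (dvdn_odd qL oL) qL.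
rewrite (big_rem _ pn) /= pq1 lerDl sumr_ge0 // => i _.
by rewrite invr_ge0 ler0n.
Qed.

(** Let p1 be the least prime factor of n and t1 the integer part of log2 p1.
    Each prime p of n contributes at most
    log2 p / (2p) <= (t1 + 1) / (2 p1), and n has at most p1 / (2 t1) prime
    factors, so the sum is at most (1 + 1/t1) / 4 <= 3/8, as t1 >= 2. *)
Lemma lehmer_lucas_sum_inv n : lehmer (lucas n) ->
  \sum_(q <- primes (lucas n)) (q%:R : rat)^-1 < 2%:R^-1.
Proof.
move=> lL; have on := lehmer_lucas_odd_index lL; have oL := lehmer_odd lL.
have n1 : (1 < n)%N.
  by case: n on lL {oL} => [|[|]].
set p1 := pdiv n; have p1n : p1 \in primes n.
  by rewrite mem_primes pdiv_prime // pdiv_dvd ltnW.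
have p1_5 := lucas_index_prime_ge5 on oL p1n.
have p1_0 : (0 < p1)%N by apply: leq_trans p1_5.
set t1 := trunc_log 2 p1.
apply: le_lt_trans (sum_inv_primes_lucas on oL) _.
apply: (@le_lt_trans _ _ (\sum_(p <- primes n) t1.+1%:R / (2 * p1)%:R)).
  rewrite big_seq [leRHS]big_seq; apply: ler_sum => p pn.
  have p5 := lucas_index_prime_ge5 on oL pn.
  have p0 : (0 < p)%N by apply: leq_trans p5.
  have := pn; rewrite mem_primes => /and3P[pp _ pdn].
  have t2 : (0 < trunc_log 2 p)%N by rewrite trunc_log_gt0 /= (ltn_trans _ p5).
  apply: (@le_trans _ _ ((trunc_log 2 p)%:R / (2 * p)%:R)).
    apply: sum_inv_mod1 (primes_uniq _) _ _; first exact: dvdn_odd pdn on.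
      move=> q; rewrite mem_primes => /and3P[pq _ qL].
      by rewrite (dvdn_odd qL oL) prime_gt1.
    apply: leq_ltn_trans (leq_pmull _ t2) _;
      apply: leq_ltn_trans (lehmer_lucas_count lL pn) _.
    have := trunc_log_ltn p (ltnSn 1); rewrite expnS.
    by rewrite -[X in (X < _)%N]odd_double_half -mul2n; lia.
  rewrite ler_pdivrMr ?ltr0n ?muln_gt0 // mulrAC ler_pdivlMr ?ltr0n ?muln_gt0
    //.
  rewrite -!natrM ler_nat 2!(mulnCA _ 2) leq_mul2l /=.
  by apply: trunc_log_ratio => //; apply: pdiv_min_dvd (prime_gt1 pp) pdn.
rewrite big_const_seq count_predT iter_addr addr0 -[ltLHS]mulr_natl mulrA.
rewrite ltr_pdivrMr ?ltr0n ?muln_gt0 // natrM mulKf ?pnatr_eq0 // -natrM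
  ltr_nat.
have t1_2 : (1 < t1)%N by apply: trunc_log_max => //; apply: ltnW.
have st : (size (primes n) * t1 <= p1./2)%N.
  rewrite mulnC; apply: leq_trans (lehmer_lucas_count lL p1n);
    rewrite leq_mul2l.
  apply/orP; right; apply: lucas_omega_bound => //.
    by apply: lehmer_squarefree (lucas_gt0 _) _; case/andP: lL.
  by move=> r /(lucas_index_prime_ge5 on oL); apply: leq_trans.
have : (size (primes n) * 2 <= size (primes n) * t1)%N by rewrite leq_mul2l
  t1_2 orbT.
rewrite mulnS; lia.
Qed.

Lemma lehmer_lucas_lt_totient n :
  lehmer (lucas n) -> (lucas n < 2 * totient (lucas n))%N.
Proof.
move=> lL; have S := lehmer_lucas_sum_inv lL; have L0 := lucas_gt0 n.
have sf : squarefree (lucas n) by apply: lehmer_squarefree L0 _; case/andP: lL.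
have primes_pos : all (leq 1) (primes (lucas n)).
  by apply/allP=> q; rewrite mem_primes => /andP[/prime_gt0].
have := prod_pred_ge primes_pos.
rewrite -totient_squarefree // -squarefree_prod // => H.
rewrite -(ltr_nat rat) natrM; apply: lt_le_trans (ler_wpM2l _ H) => //.
rewrite mulrCA -[ltLHS]mulr1 ltr_pM2l ?ltr0n // mulrBr mulr1 ltrBrDr -ltrBrDl.
by rewrite (_ : 2%:R - 1 = 1 :> rat) // mulrC -ltr_pdivlMr // mul1r.
Qed.

End Estimate.

Theorem theorem1 : ~ exists n : nat, lehmer (lucas n).
Proof.
case=> n lL; have [cL tL] := andP lL.
have big := lehmer_lucas_lt_totient lL.
have [k kE] := dvdnP tL.
have := totient_composite cL; rewrite kE.
case: k kE => [|[|k]] kE; rewrite ?mul0n ?mul1n ?ltnn //.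
have : 2 * totient (lucas n) <= k.+2 * totient (lucas n) by rewrite leq_mul2r
  orbT.
lia.
Qed.
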